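(* Let $H$ be the discrete Heisenberg group. For each positive integer $N$ there exists an automorphism $\phi$ of the group $H$ such that $R(\phi)=2N$.
   Context: The discrete Heisenberg group $H=\mathbb{Z}^2\rtimes\mathbb{Z}$ is the set of triplets $((m,k),s)$ of integers with multiplication $((m,k),s)*((m',k'),s')=((m+m',\,k+k'+sm'),\,s+s')$. For an automorphism $\phi$ of a group $G$, elements $x,x'\in G$ are $\phi$-conjugate if there is $g\in G$ with $x'=g\,x\,\phi(g^{-1})$; this is an equivalence relation and the Reidemeister number $R(\phi)$ is the number of its equivalence classes. *)

(* Defs.v *)
From HB Require Import structures.
From mathcomp Require Import all_boot all_order all_algebra.
From mathcomp Require Import ring.
From mathcomp Require Import all_classical.

Set Implicit Arguments.
Unset Strict Implicit.
Unset Printing Implicit Defensive.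

Import GRing.Theory.

Local Open Scope classical_set_scope.
Local Open Scope card_scope.

Section Reidemeister.
Local Open Scope group_scope.
Variables (G : groupType) (phi : G -> G).

Definition twisted_conj (x x' : G) : Prop := exists g : G, x' = g * x * phi g^-1.

Definition twisted_class (x : G) : set G := [set x' | twisted_conj x x'].

Definition reidemeister_classes : set (set G) := range twisted_class.

(* In particular, this asserts that R(phi) is finite. *)
Definition reidemeister_number_eq (n : nat) : Prop :=
  reidemeister_classes #= `I_n.

End Reidemeister.

Section TwistedConjEquiv.
Local Open Scope group_scope.
Variables (G : groupType) (phi : {multiplicative G -> G}).

Let phi1 : phi 1 = 1.
Proof. by apply: (@mulgI _ (phi 1)); rewrite -gmulfM !mulg1. Qed.

Lemma twisted_conj_refl x : twisted_conj phi x x.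
Proof. by exists 1; rewrite invg1 phi1 mul1g mulg1. Qed.

Lemma twisted_conj_sym x y : twisted_conj phi x y -> twisted_conj phi y x.
Proof.
case=> g ->; exists g^-1.
by rewrite invgK !mulgA mulVg mul1g -mulgA -gmulfM mulVg phi1 mulg1.
Qed.

Lemma twisted_conj_trans x y z :
  twisted_conj phi x y -> twisted_conj phi y z -> twisted_conj phi x z.
Proof. by case=> g -> [h ->]; exists (h * g); rewrite invgM gmulfM !mulgA. Qed.

End TwistedConjEquiv.

Definition heis : Type := (int * int) * int.

HB.instance Definition _ := Choice.on heis.

Section HeisenbergGroup.
Local Open Scope ring_scope.

Definition heis_mul (x y : heis) : heis :=
  let: ((m, k), s) := x in
  let: ((m', k'), s') := y in
  ((m + m', k + k' + s * m'), s + s').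

Definition heis_one : heis := ((0, 0), 0).

Definition heis_inv (x : heis) : heis :=
  let: ((m, k), s) := x in ((- m, - k + s * m), - s).

Lemma heis_mulA : associative heis_mul.
Proof.
move=> [[m1 k1] s1] [[m2 k2] s2] [[m3 k3] s3] /=.
by congr ((_, _), _); ring.
Qed.

Lemma heis_mul1 : left_id heis_one heis_mul.
Proof. by move=> [[m k] s] /=; congr ((_, _), _); ring. Qed.

Lemma heis_mulr1 : right_id heis_one heis_mul.
Proof. by move=> [[m k] s] /=; congr ((_, _), _); ring. Qed.

Lemma heis_mulV : left_inverse heis_one heis_inv heis_mul.
Proof. by move=> [[m k] s] /=; congr ((_, _), _); ring. Qed.

Lemma heis_mulrV : right_inverse heis_one heis_inv heis_mul.
Proof. by move=> [[m k] s] /=; congr ((_, _), _); ring. Qed.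

End HeisenbergGroup.

HB.instance Definition _ := isGroup.Build heis
  heis_mulA heis_mul1 heis_mulr1 heis_mulV heis_mulrV.

(* Main.v *)
Require Import Defs.
From HB Require Import structures.
From mathcomp Require Import all_boot all_order all_algebra.
From mathcomp Require Import zify ring.
From mathcomp Require Import all_classical.

(** An automorphism inducing [A] on the abelianization [Z^2] of [H] acts on the
    centre [Z] as multiplication by [det A].  Take [A = ((N, 1), (1, 0))]: it
    has determinant [-1] and [det (1 - A) = - N], so there are [N] twisted
    classes in the abelianization.  As [A] has no nonzero fixed point, the
    fibre over each of them consists of [#|Z / (1 - (-1))Z| = 2] classes. *)

Import GRing.Theory Num.Theory.

Lemma twisted_classP {G : groupType} {phi : {multiplicative G -> G}} {x y : G} :
  twisted_class phi x = twisted_class phi y <-> twisted_conj phi x y.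
Proof.
split=> [xy | xy].
  have : twisted_class phi y y by apply: twisted_conj_refl.
  by rewrite -xy.
apply/seteqP; split=> z; apply: twisted_conj_trans => //.
exact: twisted_conj_sym.
Qed.

Lemma reidemeister_number_transversal (G : groupType)
    (phi : {multiplicative G -> G}) (n : nat) (rep : nat -> G) :
    (forall x, exists2 i, (i < n)%N & twisted_conj phi x (rep i)) ->
    (forall i j, (i < n)%N -> (j < n)%N ->
      twisted_conj phi (rep i) (rep j) -> i = j) ->
  reidemeister_number_eq phi n.
Proof.
move=> rep_surj rep_inj; rewrite /reidemeister_number_eq.
have -> : reidemeister_classes phi = ((twisted_class phi \o rep) @` `I_n)%classic.
  apply/seteqP; split=> [_ [x _ <-] | _ [i _ <-]]; last by exists (rep i).
  by have [i lt_in xi] := rep_surj x; exists i => //; apply/esym/twisted_classP.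
apply: inj_card_eq => i j; rewrite !inE => lt_in lt_jn /twisted_classP.
exact: rep_inj.
Qed.

Section HeisenbergAutomorphism.
Local Open Scope ring_scope.

Lemma heis_mulE x y : (x * y)%g = heis_mul x y.
Proof. by []. Qed.

Definition triangular (m : int) : int := ((m * (m - 1)) %/ 2)%Z.

Lemma triangularE m : triangular m * 2 = m * (m - 1).
Proof.
apply: divzK; suff [k ->] : exists k, m * (m - 1) = k * 2 by apply: dvdz_mull.
have [e | e] : m = (m %/ 2)%Z * 2 \/ m = (m %/ 2)%Z * 2 + 1 by lia.
- by exists ((m %/ 2)%Z * (m - 1)); rewrite {1}e; ring.
- by exists (m * (m %/ 2)%Z); rewrite {2}e; ring.
Qed.

Lemma triangularD m n : triangular (m + n) = triangular m + triangular n + m * n.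
Proof. by apply: (@mulIf _ 2) => //; rewrite !mulrDl !triangularE; ring. Qed.

Lemma triangular0 : triangular 0 = 0.
Proof. by []. Qed.

Variable N : nat.

(* Multiplicativity forces the quadratic part [q m s] of the central coordinate
   to have polarization [s m' + m s' + N m m']; [triangular m] replaces
   [m ^+ 2 / 2], which is not integral. *)
Definition heis_aut (x : heis) : heis :=
  let: ((m, k), s) := x in
  ((N%:Z * m + s, - k + m * s + N%:Z * triangular m), m).

Definition heis_aut_inv (x : heis) : heis :=
  let: ((m, k), s) := x in
  ((s, - k + s * (m - N%:Z * s) + N%:Z * triangular s), m - N%:Z * s).

Lemma heis_autM : {morph heis_aut : x y / (x * y)%g}.
Proof.
move=> [[m k] s] [[m' k'] s']; rewrite !heis_mulE /= triangularD.
by congr ((_, _), _); ring.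
Qed.

Lemma heis_aut1 : heis_aut 1%g = 1%g.
Proof. by rewrite /= !mulr0 addr0. Qed.

HB.instance Definition _ := isMultiplicative.Build heis heis heis_aut heis_autM.
HB.instance Definition _ :=
  Multiplicative_isUMagmaMorphism.Build heis heis heis_aut heis_aut1.

Lemma heis_aut_bij : bijective heis_aut.
Proof.
by exists heis_aut_inv => -[[m k] s] /=; congr ((_, _), _); ring.
Qed.

(** Multiplying by [heis_aut g] on the right avoids inverting [g = ((a, b), c)]. The central part
    [b] contributes [b] on one side and [- b] on the other, hence the term [b * 2]. *)
Lemma heis_twisted_conjP m k s m' k' s' :
  twisted_conj heis_aut ((m, k), s) ((m', k'), s') <->
  exists a b c : int,
    [/\ m' = m + a - N%:Z * a - c, s' = s + c - a &
        k' = k + b * 2 + c * m - a * c - N%:Z * triangular a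
             - s' * (N%:Z * a + c)].
Proof.
have conjE (x y g : heis) :
    y = (g * x * heis_aut g^-1)%g <-> (y * heis_aut g)%g = (g * x)%g.
  rewrite gmulfV; split=> [-> | <-]; first by rewrite mulgVK.
  by rewrite mulgK.
split=> [[[[a b] c]] /conjE[em ek es] | [a [b [c [em es ek]]]]].
  by exists a, b, c; split; lia.
exists ((a, b), c); apply/conjE; rewrite !heis_mulE /= ek em es.
by congr ((_, _), _); ring.
Qed.

(** For [i < 2 * N], the remainder selects a class in the abelianization, where [m + s] modulo [N]
    is the invariant; the quotient, [0] or [1], selects a class in its fibre. *)
Definition heis_rep (i : nat) : heis := (((i %% N)%N%:Z, (i %/ N)%N%:Z), 0).

Hypothesis N_gt0 : (0 < N)%N.

Lemma heis_rep_surj x :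
  exists2 i, (i < 2 * N)%N & twisted_conj heis_aut x (heis_rep i).
Proof.
case: x => [[m k] s].
(* The target [s' = 0] forces [c = a - s], so [m' = m + s - N a] and [a] must be a Euclidean
   quotient. Then [k' = t + 2 b], and [b] reduces [t] modulo [2]. *)
pose a := ((m + s) %/ N%:Z)%Z; pose c := a - s.
pose t := k + c * m - a * c - N%:Z * triangular a.
have [r [lt_rN er]] : exists r : nat, (r < N)%N /\ m + s = a * N%:Z + r%:Z.
  exists `|((m + s) %% N%:Z)%Z|%N.
  have r_ge0 : 0 <= ((m + s) %% N%:Z)%Z by apply: modz_ge0; lia.
  have r_lt : ((m + s) %% N%:Z)%Z < N%:Z by apply: ltz_pmod; lia.
  have := divz_eq (m + s) N%:Z; rewrite -/a => e; split; lia.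
have [e [lt_e2 ee]] : exists e : nat, (e < 2)%N /\ t = (t %/ 2)%Z * 2 + e%:Z.
  by exists `|(t %% 2)%Z|%N; lia.
exists (e * N + r)%N; first by nia.
rewrite /heis_rep modnMDl modn_small // divnMDl // divn_small // addn0.
apply/heis_twisted_conjP; exists a, (- (t %/ 2)%Z), c; split.
- by rewrite /c; lia.
- by rewrite /c; lia.
- by rewrite mul0r subr0; rewrite /t in ee *; lia.
Qed.

Lemma heis_rep_inj i j : (i < 2 * N)%N -> (j < 2 * N)%N ->
  twisted_conj heis_aut (heis_rep i) (heis_rep j) -> i = j.
Proof.
move=> lt_i lt_j /heis_twisted_conjP[a [b [c [em es ek]]]].
have ca : c = a by lia.
have lt_iN := ltn_pmod i N_gt0; have lt_jN := ltn_pmod j N_gt0.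
(* With [c = a], the two remainders differ by [N a], while both lie in [[0, N)]. Hence the
   conjugating element is central. *)
have a0 : a = 0 by nia.
have qi : (i %/ N < 2)%N by rewrite ltn_divLR.
have qj : (j %/ N < 2)%N by rewrite ltn_divLR.
move: em ek; rewrite ca a0 triangular0 => em ek.
have er : (i %% N = j %% N)%N by lia.
(* What is left of [ek] says that the quotients differ by [2 b]; both are below [2]. *)
have eq : (i %/ N = j %/ N)%N.
  move: qi qj ek; rewrite !mul0r !mulr0; move: (i %/ N)%N (j %/ N)%N; clear=> u v.
  lia.
by rewrite (divn_eq i N) (divn_eq j N) er eq.
Qed.

End HeisenbergAutomorphism.

Theorem lemma1 (N : nat) (hN : (0 < N)%N) :
  exists phi : {multiplicative heis -> heis},
    bijective phi /\ reidemeister_number_eq phi (2 * N)%N.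
Proof.
exists (heis_aut N); split; first exact: heis_aut_bij.
apply: (@reidemeister_number_transversal _ _ _ (heis_rep N)).
- exact: heis_rep_surj.
- exact: heis_rep_inj.
Qed.
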